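(* Let $\Omega$ be a Polish space equipped with a $\sigma$-additive $\sigma$-finite Borel measure $P$, let $\mathcal P$ be a family of probability densities on $\Omega$ with respect to $P$, and let $X_i\subset\mathcal P$, $i=1,\dots,m$, and $Y_j\subset\mathcal P$, $j=1,\dots,n$. Let $\phi_{ij}:\Omega\to\mathbb R$ be Borel functions and $\epsilon_{ij}>0$ be reals such that for all $i\le m$, $j\le n$ $$\int_\Omega e^{-\phi_{ij}(\omega)}p(\omega)P(d\omega)\le\epsilon_{ij}\ \ \forall p\in X_i,\qquad \int_\Omega e^{\phi_{ij}(\omega)}q(\omega)P(d\omega)\le\epsilon_{ij}\ \ \forall q\in Y_j.$$ Let $E=[\epsilon_{ij}]\in\mathbb R^{m\times n}$, let $\|E\|_{2,2}$ be its spectral norm, and let $g\in\mathbb R^m$, $h\in\mathbb R^n$ be entrywise positive vectors such that $Eh=\|E\|_{2,2}\,g$, $E^Tg=\|E\|_{2,2}\,h$ (such vectors exist by the Perron--Frobenius theorem). Set $a_{ij}=\ln(h_j/g_i)$ and $$\phi(\omega)=\max_{1\le i\le m}\ \min_{1\le j\le n}\ [\phi_{ij}(\omega)-a_{ij}].$$ Let $X=\bigcup_{i=1}^mX_i$, $Y=\bigcup_{j=1}^nY_j$. Then $$\int_\Omega e^{-\phi(\omega)}p(\omega)P(d\omega)\le\varepsilon:=\|E\|_{2,2}\ \ \forall p\in X,\qquad \int_\Omega e^{\phi(\omega)}p(\omega)P(d\omega)\le\varepsilon\ \ \forall p\in Y.$$ As a result, the risk of the test which, given an observation $\omega$, accepts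 $H_X$ when $\phi(\omega)\ge0$ and accepts $H_Y$ otherwise, does not exceed $\varepsilon=\|E\|_{2,2}$ when testing $H_X$ versus $H_Y$.
   Context: The observation $\omega$ is drawn from a distribution with density $p$ with respect to $P$. Hypothesis $H_X$ states that $p\in X$ and $H_Y$ that $p\in Y$. The risk of a test is the maximum of the supremum over $p\in X$ of the $p$-probability to reject $H_X$ and the supremum over $p\in Y$ of the $p$-probability to reject $H_Y$. *)

(* Defs.v *)
From HB Require Import structures.
From mathcomp Require Import all_boot all_order all_algebra.
From mathcomp Require Import all_classical all_reals all_analysis.

Set Implicit Arguments.
Unset Strict Implicit.
Unset Printing Implicit Defensive.

Import Order.TTheory GRing.Theory Num.Theory.
Import numFieldNormedType.Exports.

Local Open Scope classical_set_scope.
Local Open Scope ring_scope.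

Definition separable (T : topologicalType) : Prop :=
  exists2 A : set T, countable A & dense A.

Definition is_metric (R : realType) (T : Type) (d : T -> T -> R) : Prop :=
  [/\ forall x y, 0 <= d x y,
      forall x y, d x y = 0 <-> x = y,
      forall x y, d x y = d y x &
      forall x y z, d x z <= d x y + d y z].

Definition metrizes (R : realType) (T : topologicalType) (d : T -> T -> R)
    : Prop :=
  forall (x : T) (A : set T),
    nbhs x A <-> exists2 e : R, 0 < e & [set y | d x y < e] `<=` A.

Definition complete_metric (R : realType) (T : topologicalType)
    (d : T -> T -> R) : Prop :=
  forall u : nat -> T,
    (forall e : R, 0 < e -> exists N : nat, forall k l : nat,
        (N <= k)%N -> (N <= l)%N -> d (u k) (u l) < e) ->
    exists x : T, u @ \oo --> x.

Definition polish (R : realType) (T : topologicalType) : Prop :=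
  separable T /\
  exists d : T -> T -> R,
    [/\ is_metric d, metrizes d & complete_metric d].

Notation borel T := (g_sigma_algebraType (@open T)).

Definition density (R : realType) (T : ptopologicalType)
    (P : {measure set (borel T) -> \bar R}) (p : borel T -> R) : Prop :=
  [/\ measurable_fun [set: borel T] p,
      forall w, 0 <= p w &
      (\int[P]_w (p w)%:E = 1)%E].

Definition density_prob (R : realType) (T : ptopologicalType)
    (P : {measure set (borel T) -> \bar R}) (p : borel T -> R)
    (A : set (borel T)) : \bar R :=
  (\int[P]_(w in A) (p w)%:E)%E.

(* A test is a map [borel T -> bool]: on observation [w] it accepts H_X (and
   rejects H_Y) if [test w = true], and accepts H_Y (and rejects H_X) if
   [test w = false]. The supremum over an empty hypothesis is -oo. *)
Definition risk (R : realType) (T : ptopologicalType)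
    (P : {measure set (borel T) -> \bar R}) (X Y : set (borel T -> R))
    (test : borel T -> bool) : \bar R :=
  maxe (ereal_sup [set density_prob P p [set w | test w = false] | p in X])
       (ereal_sup [set density_prob P p [set w | test w = true] | p in Y]).

Definition norm2 (R : realType) (n : nat) (x : 'cV[R]_n) : R :=
  Num.sqrt (\sum_(i < n) x i 0 ^+ 2).

Definition spectral_norm (R : realType) (m n : nat) (E : 'M[R]_(m, n)) : R :=
  sup [set norm2 (E *m x) | x in [set x : 'cV[R]_n | norm2 x <= 1]].

Definition perron_pair (R : realType) (m n : nat) (E : 'M[R]_(m, n))
    (g : 'cV[R]_m) (h : 'cV[R]_n) : Prop :=
  [/\ forall i, 0 < g i 0,
      forall j, 0 < h j 0,
      E *m h = spectral_norm E *: g &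
      E^T *m g = spectral_norm E *: h].

(* The index sets are nonempty, so the value at [ord0] is a harmless initial
   value for the iterated max and min. *)
Definition ord_maxr (R : realType) (n : nat) (F : 'I_n.+1 -> R) : R :=
  \big[Num.max/F ord0]_(i < n.+1) F i.

Definition ord_minr (R : realType) (n : nat) (F : 'I_n.+1 -> R) : R :=
  \big[Num.min/F ord0]_(i < n.+1) F i.

Definition detector (R : realType) (T : Type) (m n : nat)
    (phi : 'I_m.+1 -> 'I_n.+1 -> T -> R)
    (g : 'cV[R]_m.+1) (h : 'cV[R]_n.+1) (w : T) : R :=
  ord_maxr (fun i => ord_minr (fun j => phi i j w - ln (h j 0 / g i 0))).

(* Main.v *)
Require Import Defs.
From HB Require Import structures.
From mathcomp Require Import all_boot all_order all_algebra.
From mathcomp Require Import all_classical all_reals all_analysis.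
From mathcomp Require Import ring lra measurable_realfun.

Set Implicit Arguments.
Unset Strict Implicit.
Unset Printing Implicit Defensive.

Import Order.TTheory GRing.Theory Num.Theory.
Import numFieldNormedType.Exports.

Local Open Scope classical_set_scope.
Local Open Scope ring_scope.

(** The two integral bounds rest on pointwise estimates of the detector. If
    [p] lies in [X i], then bounding the outer maximum from below by its [i]-th
    term and writing the exponential of minus a minimum as a maximum of
    exponentials, which is at most their sum, gives
      [exp (- phi) <= \sum_j (h_j / g_i) exp (- phi_ij)]
    ([expRN_detector_le]). Integrating against [p] bounds the left-hand side by
    [\sum_j eps_ij h_j / g_i = (E h)_i / g_i], which is the spectral norm of [E].
    If [p] lies in [Y j], the inner minimum is at most its [j]-th term and the
    maximum over [i] of exponentials is at most their sum
    ([expR_detector_le]), so that the bound is [(E^T g)_j / h_j], the spectral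
    norm again. The shifts [ln (h_j / g_i)] serve to make all these weighted
    row and column sums agree. The risk bound is Markov's
    inequality ([markov_density]): on the event where a hypothesis is rejected,
    the corresponding exponential is at least 1.

    The vectors [g] and [h] come from a maximization. The norm of [E x] reaches
    its maximum [s] on the unit ball, by compactness, and since
    [E] is positive, replacing the entries of a maximizer by their absolute
    values yields a nonnegative maximizer [h]. Put [g = E h / s], a unit vector.
    Then
      [|E^T g - s h|^2 = |E^T g|^2 - 2 s <g, E h> + s^2 = |E^T g|^2 - s^2],
    and [|E^T g|^2 = <E E^T g, g> <= s |E^T g|] by the Cauchy-Schwarz
    inequality, so the right-hand side is nonpositive and [E^T g = s h]
    ([perron_of_maximizer]). A positive matrix sends nonzero nonnegative vectors
    to positive ones, so [g], and then [h], are positive. *)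

(** * Inner product and Euclidean norm of column vectors *)

Section Perron.
Variable R : realType.
Implicit Types m n : nat.

Definition dot n (x y : 'cV[R]_n) : R := \sum_(i < n) x i 0 * y i 0.

Lemma dotE n (x y : 'cV[R]_n) : dot x y = (x^T *m y) 0 0.
Proof. by rewrite mxE; apply: eq_bigr => i _; rewrite mxE. Qed.

Lemma dotC n (x y : 'cV[R]_n) : dot x y = dot y x.
Proof. by apply: eq_bigr => i _; rewrite mulrC. Qed.

Lemma dot_adjoint m n (E : 'M[R]_(m, n)) (x : 'cV[R]_n) (y : 'cV[R]_m) :
  dot (E *m x) y = dot x (E^T *m y).
Proof. by rewrite !dotE trmx_mul mulmxA. Qed.

Lemma dotZl n (a : R) (x y : 'cV[R]_n) : dot (a *: x) y = a * dot x y.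
Proof. by rewrite mulr_sumr; apply: eq_bigr => i _; rewrite mxE mulrA. Qed.

Lemma dot_ge0 n (x : 'cV[R]_n) : 0 <= dot x x.
Proof. by apply: sumr_ge0 => i _; rewrite -expr2 sqr_ge0. Qed.

Lemma norm2_sqr n (x : 'cV[R]_n) : norm2 x ^+ 2 = dot x x.
Proof.
rewrite sqr_sqrtr; first by apply: eq_bigr => i _; rewrite expr2.
by apply: sumr_ge0 => i _; rewrite sqr_ge0.
Qed.

Lemma norm2_ge0 n (x : 'cV[R]_n) : 0 <= norm2 x.
Proof. exact: sqrtr_ge0. Qed.

Lemma dot_combination n (a b : R) (x y : 'cV[R]_n) :
  dot (a *: x - b *: y) (a *: x - b *: y) =
  a ^+ 2 * dot x x - 2 * (a * b) * dot x y + b ^+ 2 * dot y y.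
Proof.
rewrite /dot !mulr_sumr -sumrB -big_split /=; apply: eq_bigr => i _.
by rewrite !mxE; ring.
Qed.

Lemma dot_eq0 n (x : 'cV[R]_n) : dot x x <= 0 -> x = 0.
Proof.
move=> x0; have /eqP : dot x x = 0 by apply/eqP; rewrite eq_le x0 dot_ge0.
rewrite psumr_eq0 => [/allP xi0|i _]; last by rewrite -expr2 sqr_ge0.
apply/colP => i; rewrite mxE; have := xi0 i (mem_index_enum i).
by rewrite -expr2 sqrf_eq0 => /eqP.
Qed.

Lemma norm2_0 n : norm2 (0 : 'cV[R]_n) = 0.
Proof. by rewrite /norm2 big1 ?sqrtr0// => i _; rewrite mxE expr0n. Qed.

Lemma norm2_gt0 n (x : 'cV[R]_n) : x != 0 -> 0 < norm2 x.
Proof.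
move=> x0; rewrite lt_neqAle norm2_ge0 andbT eq_sym.
apply: contra_neq x0 => x0; apply: dot_eq0.
by rewrite -norm2_sqr x0 expr0n.
Qed.

Lemma norm2Z n (a : R) (x : 'cV[R]_n) : norm2 (a *: x) = `|a| * norm2 x.
Proof.
rewrite /norm2 -sqrtr_sqr -sqrtrM ?sqr_ge0// mulr_sumr.
by congr Num.sqrt; apply: eq_bigr => i _; rewrite mxE exprMn.
Qed.

(** This is the nonnegativity of the square of [|y| x - |x| y], divided by
    [2 |x| |y|]. *)
Lemma cauchy_schwarz n (x y : 'cV[R]_n) : dot x y <= norm2 x * norm2 y.
Proof.
have [->|x0] := eqVneq x 0.
  by rewrite norm2_0 mul0r /dot big1// => i _; rewrite mxE mul0r.
have [->|y0] := eqVneq y 0.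
  by rewrite norm2_0 mulr0 /dot big1// => i _; rewrite mxE mulr0.
have xy : 0 < norm2 x * norm2 y by rewrite mulr_gt0// norm2_gt0.
rewrite -(ler_pM2l xy).
have := dot_ge0 (norm2 y *: x - norm2 x *: y).
by rewrite dot_combination -!norm2_sqr => ?; nra.
Qed.

Lemma norm2_le_abs n (x y : 'cV[R]_n) :
  (forall i, `|x i 0| <= y i 0) -> norm2 x <= norm2 y.
Proof.
move=> xy; rewrite ler_wsqrtr//; apply: ler_sum => i _.
by rewrite -(real_normK (num_real (x i 0))) lerXn2r// nnegrE (le_trans _ (xy i)).
Qed.

Lemma coord_le_norm2 n (x : 'cV[R]_n) i : `|x i 0| <= norm2 x.
Proof.
rewrite -sqrtr_sqr ler_wsqrtr// (bigD1 i)//= lerDl.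
by apply: sumr_ge0 => j _; rewrite sqr_ge0.
Qed.

(** * The spectral norm is attained *)

(** The argument is a row vector, to match [rV_compact], through which the unit
    ball is shown to be compact. *)
Lemma continuous_norm2_mulmx m n (E : 'M[R]_(m, n)) :
  continuous (fun x : 'rV[R]_n => norm2 (E *m x^T)).
Proof.
move=> x; apply: (cvg_comp (fun x => \sum_(i < m) (E *m x^T) i 0 ^+ 2) Num.sqrt);
  last by apply: sqrt_continuous.
apply: (@continuous_big _ _ _ _ _ _ _ _
    (fun i (x : 'rV[R]_n) => (E *m x^T) i 0 ^+ 2)) => [|i _ {}x].
  exact: add_continuous.
apply: (continuous_comp (f := fun x : 'rV[R]_n => (E *m x^T) i 0)
                        (g := fun y : R => y ^+ 2)); last first.
  exact: exprn_continuous.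
have -> : (fun x : 'rV[R]_n => (E *m x^T) i 0) =
          (fun x => \sum_(j < n) E i j * x 0 j).
  by apply/funext => y; rewrite mxE; apply: eq_bigr => j _; rewrite mxE.
apply: continuous_big => [|j _ y]; first exact: add_continuous.
by apply: (@continuousM _ _ (cst (E i j)) (fun x : 'rV[R]_n => x 0 j));
  [exact: cst_continuous|exact: coord_continuous].
Qed.

(** The ball is closed in the cube [[-1, 1]^n], which is compact as a finite
    product of compact intervals. *)
Lemma compact_unit_ball n : compact [set x : 'rV[R]_n | norm2 x^T <= 1].
Proof.
apply: (@subclosed_compact _ _
  [set x : 'rV[R]_n | forall j, `[-1, 1]%classic (x 0 j)]).
- apply: (@preimage_closed _ _ (fun x : 'rV[R]_n => norm2 x^T)
    [set y | y <= 1]); last exact: closed_le.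
  move=> x _; have := @continuous_norm2_mulmx n n 1%:M x.
  by under eq_fun do rewrite mul1mx.
- by apply: (@rV_compact R n (fun=> `[-1, 1]%classic)) => j;
  exact: segment_compact.
- move=> x /= x1 j; rewrite in_itv/= -ler_norml.
  by apply: le_trans x1; have := coord_le_norm2 x^T j; rewrite mxE.
Qed.

(** Compactness of the unit ball shows at once that the supremum defining the
    spectral norm is over a bounded set and that it is a maximum. *)
Lemma spectral_norm_attained m n (E : 'M[R]_(m, n)) :
  exists x : 'cV[R]_n, [/\ norm2 x <= 1, norm2 (E *m x) = spectral_norm E &
    forall y, norm2 y <= 1 -> norm2 (E *m y) <= spectral_norm E].
Proof.
have [||x /[!inE]/= x1 xmax] := @compact_EVT_max _ _
    (fun x : 'rV[R]_n => norm2 (E *m x^T)) _ _ (@compact_unit_ball n).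
- by exists 0 => /=; rewrite trmx0 norm2_0.
- by apply: continuous_subspaceT; exact: continuous_norm2_mulmx.
have {}xmax (y : 'cV[R]_n) : norm2 y <= 1 -> norm2 (E *m y) <= norm2 (E *m x^T).
  by move=> y1; have := xmax y^T; rewrite inE/= !trmxK; exact.
have Ex : norm2 (E *m x^T) = spectral_norm E.
  apply/eqP; rewrite eq_le; apply/andP; split.
    apply: ub_le_sup; last by exists x^T.
    by exists (norm2 (E *m x^T)) => _ [y /= y1 <-]; exact: xmax.
  apply: ge_sup => [|_ [y /= y1 <-]]; last exact: xmax.
  by exists (norm2 (E *m x^T)), x^T.
by exists x^T; split=> // y /xmax; rewrite Ex.
Qed.

Lemma norm2_mulmx_le m n (E : 'M[R]_(m, n)) x :
  norm2 (E *m x) <= spectral_norm E * norm2 x.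
Proof.
have [->|x0] := eqVneq x 0; first by rewrite mulmx0 !norm2_0 mulr0.
have [_ [_ _ /(_ ((norm2 x)^-1 *: x))]] := spectral_norm_attained E.
have nx := norm2_gt0 x0.
rewrite -scalemxAr !norm2Z ger0_norm ?invr_ge0 ?norm2_ge0//.
rewrite mulVf ?gt_eqF// => /(_ (lexx _)).
by rewrite mulrC ler_pdivrMr.
Qed.

(** * Positive singular vectors of a positive matrix *)

(** A maximizer of [|E x|] on the unit sphere is a right singular vector: with
    [g = E h / s], the square of [|E^T g - s h|] equals [|E^T g|^2 - s^2], and
    [|E^T g| <= s] because [|E^T g|^2 = <E E^T g, g>] is at most
    [s |E^T g|]. *)
Lemma perron_of_maximizer m n (E : 'M[R]_(m, n)) (h : 'cV[R]_n) :
  0 < spectral_norm E -> norm2 h = 1 -> norm2 (E *m h) = spectral_norm E ->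
  E^T *m ((spectral_norm E)^-1 *: (E *m h)) = spectral_norm E *: h.
Proof.
set s := spectral_norm E => s0 h1 Eh.
set g := s^-1 *: (E *m h).
have g1 : norm2 g = 1.
  by rewrite norm2Z Eh ger0_norm ?invr_ge0 ?ltW// mulVf ?gt_eqF.
have gEh : E *m h = s *: g by rewrite scalerA divff ?gt_eqF// scale1r.
have Egh : dot (E^T *m g) h = s.
  by rewrite dotC -dot_adjoint gEh dotZl -norm2_sqr g1 expr1n mulr1.
have Eg : norm2 (E^T *m g) <= s.
  have [->|Eg0] := eqVneq (E^T *m g) 0; first by rewrite norm2_0 ltW.
  rewrite -(ler_pM2l (norm2_gt0 Eg0)) -expr2 norm2_sqr -dot_adjoint.
  apply: le_trans (cauchy_schwarz _ _) _.
  by rewrite g1 mulr1 mulrC; exact: norm2_mulmx_le.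
apply/eqP; rewrite -subr_eq0; apply/eqP.
apply: dot_eq0; rewrite -[E^T *m g]scale1r dot_combination Egh -!norm2_sqr h1.
have : norm2 (E^T *m g) ^+ 2 <= s ^+ 2.
  by rewrite lerXn2r// nnegrE ?norm2_ge0 ?ltW.
lra.
Qed.

Lemma mulmx_gt0 m n (E : 'M[R]_(m, n)) (x : 'cV[R]_n) :
  (forall i j, 0 < E i j) -> (forall j, 0 <= x j 0) -> x != 0 ->
  forall i, 0 < (E *m x) i 0.
Proof.
move=> E0 x0 xN0 i; rewrite mxE lt_neqAle; apply/andP; split; last first.
  by apply: sumr_ge0 => j _; rewrite mulr_ge0// ltW.
rewrite eq_sym; apply: contra_neq xN0 => /eqP.
rewrite psumr_eq0 => [/allP xj0|j _]; last by rewrite mulr_ge0// ltW.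
apply/colP => j; rewrite mxE; have := xj0 j (mem_index_enum j).
by rewrite mulf_eq0 gt_eqF//= => /eqP.
Qed.

(** Perron-Frobenius for singular vectors: positivity of the entries of [E] lets
    a maximizer be replaced by its entrywise absolute value, and makes [E] and
    its transpose send nonzero nonnegative vectors to positive ones. *)
Lemma perron_pair_exists m n (E : 'M[R]_(m.+1, n.+1)) :
  (forall i j, 0 < E i j) -> exists g h, perron_pair E g h.
Proof.
move=> E0; have [x [x1 Ex Emax]] := spectral_norm_attained E.
set s := spectral_norm E in Ex Emax *.
pose h : 'cV[R]_n.+1 := \col_j `|x j 0|.
have h1 : norm2 h <= 1.
  apply: le_trans x1; rewrite /norm2 ler_wsqrtr// ler_sum// => j _.
  by rewrite mxE real_normK ?num_real.
have Eh : norm2 (E *m h) = s.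
  apply/eqP; rewrite eq_le Emax//= -Ex; apply: norm2_le_abs => i.
  rewrite !mxE; apply: le_trans (ler_norm_sum _ _ _) _; apply: ler_sum => j _.
  by rewrite mxE normrM gtr0_norm.
have h0 j : 0 <= h j 0 by rewrite mxE.
(* Applied to the constant vector 1, this makes the spectral norm positive. *)
have E_neq0 (y : 'cV[R]_n.+1) : (forall j, 0 <= y j 0) -> y != 0 -> E *m y != 0.
  move=> y0 yN0; apply/eqP => /colP/(_ 0)/eqP.
  by rewrite [X in _ == X]mxE gt_eqF// mulmx_gt0.
have s0 : 0 < s.
  have y0 : (const_mx 1 : 'cV[R]_n.+1) != 0.
    by apply/eqP => /colP/(_ 0)/eqP; rewrite !mxE oner_eq0.
  rewrite -(pmulr_lgt0 _ (norm2_gt0 y0)).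
  apply: lt_le_trans (norm2_mulmx_le _ _).
  by apply/norm2_gt0/E_neq0 => // j; rewrite mxE.
have hN0 : h != 0.
  by apply: contraTneq s0 => hE; rewrite -Eh hE mulmx0 norm2_0 ltxx.
(* The maximizer lies on the sphere since [s = |E h| <= s |h|]. *)
have {}h1 : norm2 h = 1.
  apply/eqP; rewrite eq_le h1/= -(ler_pM2l s0) mulr1 -{1}Eh.
  exact: norm2_mulmx_le.
have Eth := perron_of_maximizer s0 h1 Eh.
set g := s^-1 *: (E *m h) in Eth.
have g0 i : 0 < g i 0 by rewrite mxE mulr_gt0 ?invr_gt0// mulmx_gt0.
have gN0 : g != 0.
  by apply/eqP => /colP/(_ 0)/eqP; rewrite [X in _ == X]mxE gt_eqF.
exists g, h; split=> //.
- move=> j; have : 0 < (E^T *m g) j 0.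
    by apply: mulmx_gt0 => // [k l|k]; [rewrite mxE|exact: ltW].
  by rewrite Eth mxE pmulr_rgt0.
- by rewrite scalerA divff ?gt_eqF// scale1r.
Qed.
End Perron.

(** * Measurability of the detector and pointwise bounds *)

Lemma ord_maxr_ge (R : realType) n (F : 'I_n.+1 -> R) i : F i <= ord_maxr F.
Proof. exact: le_bigmax. Qed.

Lemma ord_maxr_attained (R : realType) n (F : 'I_n.+1 -> R) :
  exists i, ord_maxr F = F i.
Proof.
rewrite /ord_maxr; elim/big_ind: _ => [|x y [i ->] [j ->]|i _];
  [by exists ord0| |by exists i].
by rewrite /Num.max; case: ifP => _; [exists j|exists i].
Qed.

Lemma ord_minr_le (R : realType) n (F : 'I_n.+1 -> R) j : ord_minr F <= F j.
Proof. exact: bigmin_le. Qed.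

Lemma ord_minr_attained (R : realType) n (F : 'I_n.+1 -> R) :
  exists j, ord_minr F = F j.
Proof.
rewrite /ord_minr; elim/big_ind: _ => [|x y [i ->] [j ->]|i _];
  [by exists ord0| |by exists i].
by rewrite /Num.min; case: ifP => _; [exists i|exists j].
Qed.

Lemma measurable_ord_maxr d (T : measurableType d) (R : realType) n
    (F : 'I_n.+1 -> T -> R) :
  (forall i, measurable_fun [set: T] (F i)) ->
  measurable_fun [set: T] (fun w => ord_maxr (F^~ w)).
Proof.
move=> mF; rewrite /ord_maxr; elim: (index_enum _) => [|i s IH].
  by under eq_fun do rewrite big_nil; exact: mF.
by under eq_fun do rewrite big_cons; exact: measurable_maxr.
Qed.

Lemma measurable_ord_minr d (T : measurableType d) (R : realType) n
    (F : 'I_n.+1 -> T -> R) :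
  (forall i, measurable_fun [set: T] (F i)) ->
  measurable_fun [set: T] (fun w => ord_minr (F^~ w)).
Proof.
move=> mF; rewrite /ord_minr; elim: (index_enum _) => [|i s IH].
  by under eq_fun do rewrite big_nil; exact: mF.
by under eq_fun do rewrite big_cons; exact: measurable_minr.
Qed.

Lemma measurable_detector d (T : measurableType d) (R : realType) m n
    (phi : 'I_m.+1 -> 'I_n.+1 -> T -> R) (g : 'cV[R]_m.+1) (h : 'cV[R]_n.+1) :
  (forall i j, measurable_fun [set: T] (phi i j)) ->
  measurable_fun [set: T] (detector phi g h).
Proof.
move=> mphi; apply: measurable_ord_maxr => i.
apply: measurable_ord_minr => j.
by apply: measurable_funB.
Qed.

(** With [j] the minimizer in row [i], the detector is at least
    [phi i j w - ln (h_j / g_i)], so the left-hand side is at most one term of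
    the sum. *)
Lemma expRN_detector_le (R : realType) (T : Type) m n
    (phi : 'I_m.+1 -> 'I_n.+1 -> T -> R)
    (g : 'cV[R]_m.+1) (h : 'cV[R]_n.+1) i w :
  (forall i, 0 < g i 0) -> (forall j, 0 < h j 0) ->
  expR (- detector phi g h w) <=
  \sum_(j < n.+1) (h j 0 / g i 0) * expR (- phi i j w).
Proof.
move=> g0 h0.
have hg0 j : 0 < h j 0 / g i 0 by rewrite divr_gt0.
have [j minE] := ord_minr_attained (fun j => phi i j w - ln (h j 0 / g i 0)).
apply: (@le_trans _ _ (h j 0 / g i 0 * expR (- phi i j w))).
  rewrite -[X in X * _]lnK ?posrE// -expRD ler_expR.
  rewrite lerNl opprD opprK [X in X <= _]addrC -minE.
  exact: (ord_maxr_ge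
    (fun i => ord_minr (fun j => phi i j w - ln (h j 0 / g i 0)))).
rewrite (bigD1 j)//= lerDl; apply: sumr_ge0 => k _.
by rewrite mulr_ge0 ?expR_ge0// ltW.
Qed.

(** With [i] the maximizing row, the detector is at most
    [phi i j w - ln (h_j / g_i)] for every [j], hence the term of index [i]
    dominates the left-hand side. *)
Lemma expR_detector_le (R : realType) (T : Type) m n
    (phi : 'I_m.+1 -> 'I_n.+1 -> T -> R)
    (g : 'cV[R]_m.+1) (h : 'cV[R]_n.+1) j w :
  (forall i, 0 < g i 0) -> (forall j, 0 < h j 0) ->
  expR (detector phi g h w) <=
  \sum_(i < m.+1) (g i 0 / h j 0) * expR (phi i j w).
Proof.
move=> g0 h0.
have gh0 i : 0 < g i 0 / h j 0 by rewrite divr_gt0.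
have [i maxE] := ord_maxr_attained
  (fun i => ord_minr (fun j => phi i j w - ln (h j 0 / g i 0))).
apply: (@le_trans _ _ (g i 0 / h j 0 * expR (phi i j w))).
  rewrite -[X in X * _]lnK ?posrE// -expRD ler_expR /detector maxE.
  apply: le_trans (ord_minr_le _ j) _.
  by rewrite -invf_div lnV ?posrE// opprK addrC.
rewrite (bigD1 i)//= lerDl; apply: sumr_ge0 => k _.
by rewrite mulr_ge0 ?expR_ge0// ltW.
Qed.

(** * Integral estimates *)

(** Nonnegativity of all functions makes the integrals meaningful and additive
    without any integrability assumption. *)
Lemma integral_le_sum d (T : measurableType d) (R : realType)
    (P : {measure set T -> \bar R}) n (c e : 'I_n -> R)
    (f : T -> R) (F : 'I_n -> T -> R) (p : T -> R) :
  measurable_fun [set: T] f -> (forall k, measurable_fun [set: T] (F k)) ->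
  measurable_fun [set: T] p ->
  (forall w, 0 <= f w) -> (forall k w, 0 <= F k w) -> (forall w, 0 <= p w) ->
  (forall k, 0 <= c k) ->
  (forall w, f w <= \sum_(k < n) c k * F k w) ->
  (forall k, \int[P]_w (F k w * p w)%:E <= (e k)%:E)%E ->
  (\int[P]_w (f w * p w)%:E <= (\sum_(k < n) c k * e k)%:E)%E.
Proof.
move=> mf mF mp f0 F0 p0 c0 fF Fe.
have mFp k : measurable_fun [set: T] (fun w => (F k w * p w)%:E).
  by apply/measurable_EFinP; exact: measurable_funM.
have Fp0 k w : (0 <= (F k w * p w)%:E)%E by rewrite lee_fin mulr_ge0.
have mcFp k : measurable_fun [set: T] (fun w => ((c k)%:E * (F k w * p w)%:E)%E).
  by apply: emeasurable_funM => //; exact: measurable_cst.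
apply: (@le_trans _ _
    (\int[P]_w (\sum_(k < n) (c k)%:E * (F k w * p w)%:E))%E).
  apply: ge0_le_integral => //=.
  - by move=> w _; rewrite lee_fin mulr_ge0.
  - by apply/measurable_EFinP; exact: measurable_funM.
  - exact: emeasurable_sum.
  - move=> w _; under eq_bigr do rewrite -EFinM mulrA.
    by rewrite sumEFin lee_fin -mulr_suml ler_wpM2r.
rewrite ge0_integral_sum//; last by move=> k w _; rewrite mule_ge0// lee_fin.
rewrite -sumEFin; apply: lee_sum => k _.
rewrite ge0_integralZl_EFin// EFinM.
by apply: lee_wpmul2l => //; rewrite lee_fin.
Qed.

(** Markov's inequality for the law with density [p]: [f] dominates the
    indicator of [A]. *)
Lemma markov_density d (T : measurableType d) (R : realType)
    (P : {measure set T -> \bar R}) (f p : T -> R) (A : set T) :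
  measurable A -> measurable_fun [set: T] f -> measurable_fun [set: T] p ->
  (forall w, 0 <= f w) -> (forall w, 0 <= p w) ->
  (forall w, A w -> 1 <= f w) ->
  (\int[P]_(w in A) (p w)%:E <= \int[P]_w (f w * p w)%:E)%E.
Proof.
move=> mA mf mp f0 p0 Af.
have mfp : measurable_fun [set: T] (fun w => (f w * p w)%:E).
  by apply/measurable_EFinP; exact: measurable_funM.
apply: (@le_trans _ _ (\int[P]_(w in A) (f w * p w)%:E)%E).
  apply: ge0_le_integral => //=.
  - by move=> w _; rewrite lee_fin.
  - by apply/measurable_EFinP; exact: measurable_funTS.
  - exact: measurable_funTS.
  - by move=> w /Af f1; rewrite lee_fin ler_peMl.
apply: ge0_subset_integral => //.
by move=> w _; rewrite lee_fin mulr_ge0.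
Qed.

(** * Risk of the aggregated detector *)

Theorem proposition3p1 (R : realType) (Omega : ptopologicalType)
    (polish_Omega : polish R Omega)
    (P : {measure set (borel Omega) -> \bar R})
    (sigma_finite_P : sigma_finite [set: borel Omega] P)
    (PP : set (borel Omega -> R))
    (PP_density : forall p, PP p -> density P p)
    (m n : nat)
    (X : 'I_m.+1 -> set (borel Omega -> R))
    (Y : 'I_n.+1 -> set (borel Omega -> R))
    (X_PP : forall i, X i `<=` PP)
    (Y_PP : forall j, Y j `<=` PP)
    (phi : 'I_m.+1 -> 'I_n.+1 -> borel Omega -> R)
    (phi_borel : forall i j, measurable_fun [set: borel Omega] (phi i j))
    (eps : 'I_m.+1 -> 'I_n.+1 -> R)
    (eps_gt0 : forall i j, 0 < eps i j)
    (phi_X : forall i j p, X i p ->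
       (\int[P]_w (expR (- phi i j w) * p w)%:E <= (eps i j)%:E)%E)
    (phi_Y : forall i j q, Y j q ->
       (\int[P]_w (expR (phi i j w) * q w)%:E <= (eps i j)%:E)%E) :
  let E := \matrix_(i < m.+1, j < n.+1) eps i j in
  (exists (g : 'cV[R]_m.+1) (h : 'cV[R]_n.+1), perron_pair E g h) /\
  forall (g : 'cV[R]_m.+1) (h : 'cV[R]_n.+1), perron_pair E g h ->
    let phi_all := detector phi g h in
    let XX := \bigcup_i X i in
    let YY := \bigcup_j Y j in
    [/\ forall p, XX p ->
          (\int[P]_w (expR (- phi_all w) * p w)%:E <= (spectral_norm E)%:E)%E,
        forall p, YY p ->
          (\int[P]_w (expR (phi_all w) * p w)%:E <= (spectral_norm E)%:E)%E &
        (risk P XX YY (fun w => 0 <= phi_all w)%R <= (spectral_norm E)%:E)%E].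
Proof.
move=> E.
have Ege i j : E i j = eps i j by rewrite mxE.
split; first by apply: perron_pair_exists => i j; rewrite Ege.
move=> g h [g0 h0 Eh Etg] phi_all XX YY.
have mphi : measurable_fun [set: borel Omega] phi_all.
  exact: measurable_detector.
have mephi : measurable_fun [set: borel Omega] (fun w => expR (phi_all w)).
  by apply: measurableT_comp => //; exact: measurable_expR.
have meNphi : measurable_fun [set: borel Omega] (fun w => expR (- phi_all w)).
  by apply: measurableT_comp; [exact: measurable_expR|exact: measurable_funN].
have mtest b : measurable [set w : borel Omega | (0 <= phi_all w) = b].
  have mle : measurable_fun [set: borel Omega] (fun w => 0 <= phi_all w).
    by apply: measurable_fun_ler => //; exact: measurable_cst.
  by rewrite -[X in measurable X]setTI; exact: (mle _ [set b]).
(* Row [i] of [E h = s g], divided by [g_i], evaluates the resulting sum. *)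
have XX_bound p : XX p ->
    (\int[P]_w (expR (- phi_all w) * p w)%:E <= (spectral_norm E)%:E)%E.
  move=> [i _ Xip]; have [mp p0 _] := PP_density _ (X_PP _ _ Xip).
  have -> : spectral_norm E = \sum_(j < n.+1) h j 0 / g i 0 * eps i j.
    have /colP/(_ i) := Eh; rewrite !mxE.
    move=> /esym/(canRL (mulfK (lt0r_neq0 (g0 i)))) ->.
    by rewrite mulr_suml; apply: eq_bigr => j _; rewrite mxE; ring.
  apply: (integral_le_sum (F := fun j w => expR (- phi i j w))) => //.
  - move=> j; apply: measurableT_comp; first exact: measurable_expR.
    exact: measurable_funN.
  - by move=> j; rewrite divr_ge0// ltW.
  - by move=> w; exact: expRN_detector_le.
  - by move=> j; exact: phi_X.
(* Row [j] of [E^T g = s h], divided by [h_j], evaluates the resulting sum. *)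
have YY_bound p : YY p ->
    (\int[P]_w (expR (phi_all w) * p w)%:E <= (spectral_norm E)%:E)%E.
  move=> [j _ Yjp]; have [mp p0 _] := PP_density _ (Y_PP _ _ Yjp).
  have -> : spectral_norm E = \sum_(i < m.+1) g i 0 / h j 0 * eps i j.
    have /colP/(_ j) := Etg; rewrite !mxE.
    move=> /esym/(canRL (mulfK (lt0r_neq0 (h0 j)))) ->.
    by rewrite mulr_suml; apply: eq_bigr => i _; rewrite !mxE; ring.
  apply: (integral_le_sum (F := fun i w => expR (phi i j w))) => //.
  - move=> i; apply: measurableT_comp => //; exact: measurable_expR.
  - by move=> i; rewrite divr_ge0// ltW.
  - by move=> w; exact: expR_detector_le.
  - by move=> i; exact: phi_Y.
split=> //; rewrite /risk ge_max; apply/andP; split.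
- apply: ge_ereal_sup => _ [p XXp <-]; apply: le_trans (XX_bound _ XXp).
  have [i _ Xip] := XXp; have [mp p0 _] := PP_density _ (X_PP _ _ Xip).
  apply: markov_density => //.
  move=> w /= /negbT; rewrite -ltNge => /ltW phi0.
  by rewrite -expR0 ler_expR oppr_ge0.
- apply: ge_ereal_sup => _ [p YYp <-]; apply: le_trans (YY_bound _ YYp).
  have [j _ Yjp] := YYp; have [mp p0 _] := PP_density _ (Y_PP _ _ Yjp).
  apply: markov_density => //.
  by move=> w /= ?; rewrite -expR0 ler_expR.
Qed.
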